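(* Let $L=(L,\wedge,\vee,1,0)$ be a complete lattice and $X\subseteq L\setminus\{1\}$ a subset such that $L$ is an $X$-top lattice, and equip $X$ with its Zariski-like topology. The following are equivalent: (1) $X$ is $T_{\frac12}$; (2) $X=\mathrm{Max}(X)\cup(\mathrm{Min}(X)\cap CSI^X(X))$; (3) $K.\dim(X)\le1$ and $X$ is $ES$; (4) $X$ is $T_{\frac14}$ and $X$ is $ES$.
   Context: For a complete lattice $L=(L,\wedge,\vee,1,0)$, $X\subseteq L\setminus\{1\}$ and $a\in L$, put $V(a)=\{x\in X: a\le x\}$ and $D(a)=X\setminus V(a)$. $L$ is an $X$-top lattice iff the family $\{V(a):a\in L\}$ is closed under finite unions (it always contains $X=V(0)$, $\emptyset=V(1)$ and is closed under arbitrary intersections); then the sets $D(a)$, $a\in L$, are the open sets of a topology on $X$, called the Zariski-like topology. $X$ is a poset with the order of $L$; $\mathrm{Max}(X)$, $\mathrm{Min}(X)$ are its sets of maximal and minimal elements. The empty meet is $1$. The height of $x\in X$ is $ht(x)=\sup\{n\ge 0: \text{there are } x_0<\dots<x_n=x \text{ in } X\}$, and $K.\dim(X)=\sup\{ht(x):x\in X\}$ (suprema in $\{0,1,2,\dots,\infty\}$). $CSI^X(X)$ is the set of $q\in X$ such that for every $A\subseteq X$, $\bigwedge_{a\in A}a\le q$ implies $a\le q$ for some $a\in A$. $X$ is $ES$ iff $\mathrm{Min}(X)\setminus\mathrm{Max}(X)\subseteq CSI^X(X)$, i.e. $\bigwedge_{x\in X\setminus\{m\}}x\not\le m$ for every $m\in\mathrm{Min}(X)\setminus\mathrm{Max}(X)$.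 A topological space $X$ is $T_{\frac14}$ iff for every $x\in X$, $\{x\}$ is closed or $\{x\}$ equals the intersection of all open sets containing $x$; it is $T_{\frac12}$ iff for every $x\in X$, $\{x\}$ is closed or $\{x\}$ is open. *)

(* Defs.v *)
From HB Require Import structures.
From mathcomp Require Import all_boot all_order all_algebra.
From mathcomp Require Import all_classical.
From mathcomp Require Import constructive_ereal topology measurable_structure.

Set Implicit Arguments.
Unset Strict Implicit.
Unset Printing Implicit Defensive.

Import Order.TTheory GRing.Theory Num.Theory.

Local Open Scope classical_set_scope.
Local Open Scope order_scope.

(** The library has no complete lattices. The axioms force [bigmeet set0] to
    be [\top] and [bigjoin set0] to be [\bot]. *)
HB.mixin Record TBLattice_isComplete d L of Order.TBLattice d L := {
  bigmeet : set L -> L ;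
  bigjoin : set L -> L ;
  bigmeetP : forall A : set L, infimums A (bigmeet A) ;
  bigjoinP : forall A : set L, supremums A (bigjoin A)
}.

#[short(type="completeLatticeType")]
HB.structure Definition CompleteLattice d :=
  {L of TBLattice_isComplete d L & Order.TBLattice d L}.

Definition V d (L : completeLatticeType d) (X : set L) (a : L) : set L :=
  [set x | X x /\ a <= x].

Definition D d (L : completeLatticeType d) (X : set L) (a : L) : set L :=
  X `\` V X a.

Definition Xtop d (L : completeLatticeType d) (X : set L) : Prop :=
  fin_bigcup_closed (range (V X)).

Definition zariski d (L : completeLatticeType d) (X : set L) (XT : Xtop X)
  : Type := set_type X.

Definition zariski_op d (L : completeLatticeType d) (X : set L) (XT : Xtop X)
  : set_system (zariski XT) := range (fun a => set_val @^-1` D X a).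

Lemma zariski_opT d (L : completeLatticeType d) (X : set L) (XT : Xtop X) :
  @zariski_op d L X XT setT.
Proof.
have [a _ Va] : range (V X) set0.
  have := XT unit set0 (fun=> set0) (@finite_set0 _).
  by rewrite bigcup_set0; apply.
exists a => //; apply/seteqP; split=> // x _ /=; split; first exact: set_valP.
by rewrite Va.
Qed.

Lemma zariski_opI d (L : completeLatticeType d) (X : set L) (XT : Xtop X) :
  setI_closed (@zariski_op d L X XT).
Proof.
move=> _ _ [a _ <-] [b _ <-].
have /fin_bigcup_closedP[_ VU] := XT.
have [c _ Vc] := VU _ _ (imageT (V X) a) (imageT (V X) b).
by exists c => //; rewrite /D Vc setDUr preimage_setI.
Qed.

Lemma zariski_op_bigU d (L : completeLatticeType d) (X : set L) (XT : Xtop X)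
    (I : Type) (f : I -> set (zariski XT)) :
  (forall i, zariski_op (f i)) -> zariski_op (\bigcup_i f i).
Proof.
move=> /(_ _)/cid2 fD; pose a i := s2val (fD i).
have fE i : f i = set_val @^-1` D X (a i) by rewrite /a; case: (fD i).
have [ub lub] := bigjoinP (range a).
exists (bigjoin (range a)) => //; apply/seteqP; split=> x /=.
- move=> [Xx nV]; apply: contrapT => nU; apply: nV; split=> //.
  apply: lub => _ [i _ <-]; apply: contrapT => nax; apply: nU.
  by exists i => //; rewrite fE; split=> // -[].
- move=> [i _]; rewrite fE => -[Xx nV]; split=> // -[_ le_jx]; apply: nV.
  by split=> //; apply: le_trans le_jx; apply: ub; exists i.
Qed.

HB.instance Definition _ d (L : completeLatticeType d) (X : set L)
  (XT : Xtop X) := Choice.copy (zariski XT) (set_type X).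

HB.instance Definition _ d (L : completeLatticeType d) (X : set L)
  (XT : Xtop X) := isOpenTopological.Build (zariski XT)
    (zariski_opT XT) (@zariski_opI d L X XT) (@zariski_op_bigU d L X XT).

Lemma zariski_openE d (L : completeLatticeType d) (X : set L) (XT : Xtop X)
    (U : set (zariski XT)) :
  open U <-> exists a : L, U = set_val @^-1` D X a.
Proof. by split=> [[a _ <-]|[a ->]]; exists a. Qed.

Definition MaxX d (L : completeLatticeType d) (X : set L) : set L :=
  [set x | X x /\ forall y, X y -> x <= y -> y = x].

Definition MinX d (L : completeLatticeType d) (X : set L) : set L :=
  [set x | X x /\ forall y, X y -> y <= x -> y = x].

Definition CSI d (L : completeLatticeType d) (X : set L) : set L :=
  [set q | X q /\
    forall A : set L, A `<=` X -> bigmeet A <= q -> exists2 a, A a & a <= q].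

Definition ES d (L : completeLatticeType d) (X : set L) : Prop :=
  MinX X `\` MaxX X `<=` CSI X.

Definition chain_lengths d (L : completeLatticeType d) (X : set L) (x : L)
  : set nat :=
  [set n | exists c : 'I_n.+1 -> L,
     [/\ forall i, X (c i), {homo c : i j / i < j} & c ord_max = x]].

(** Suprema in {0, 1, 2, ..., oo} are computed in [\bar int], with [0] as the
    supremum of the empty set. Every nonempty set of nonnegative elements of
    [\bar int] has a least upper bound there, so for [x] in [X] the default
    branches of [supremum] are only reached by [Kdim set0 = 0]. *)
Definition ht d (L : completeLatticeType d) (X : set L) (x : L) : \bar int :=
  supremum 0%:E%R [set (n%:Z)%:E | n in chain_lengths X x].

Definition Kdim d (L : completeLatticeType d) (X : set L) : \bar int :=
  supremum 0%:E%R [set ht X x | x in X].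

Definition T_quarter (T : topologicalType) : Prop :=
  forall x : T, closed [set x] \/
    [set x] = \bigcap_(U in [set U : set T | open U /\ U x]) U.

Definition T_half (T : topologicalType) : Prop :=
  forall x : T, closed [set x] \/ open [set x].

(* Main.v *)
Require Import Defs.
From HB Require Import structures.
From mathcomp Require Import all_boot all_order all_algebra.
From mathcomp Require Import all_classical.
From mathcomp Require Import constructive_ereal topology measurable_structure.

Local Open Scope classical_set_scope.

(** In the Zariski-like topology the closure of [{x}] is [V(x)] and the
    intersection of the open sets containing [x] is the down-set of [x] in [X].
    Hence [{x}] is closed iff [x] is maximal, equals that intersection iff [x]
    is minimal, and is open iff [x] is minimal and completely strongly
    irreducible. Moreover, [K.dim(X) <= 1] says that no element of [X] lies
    strictly between two others. *)

Import Order.TTheory.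

(** [supremum x0 A] falls back to [x0] when [A] is empty or has no least upper bound, so [x0] has to
    be bounded as well. *)
Lemma supremum_le {d} {T : porderType d} (x0 b : T) (A : set T) :
  (x0 <= b)%O -> ubound A b -> (supremum x0 A <= b)%O.
Proof.
move=> x0b Ab; rewrite /supremum; case: ifP => // _.
by case: xgetP => [y _ [_]|//]; apply.
Qed.

(** Every upper bound dominates an element [a0 >= 0], so it is [+oo] or a natural number. The least
    natural upper bound, if any exists, is the supremum; otherwise [+oo] is. *)
Lemma supremums_ereal_int_neq0 {A : set (\bar int)} :
  A !=set0 -> (forall a, A a -> (0 <= a)%E) -> supremums A !=set0.
Proof.
move=> [a0 Aa0] A0.
have ub_cases u : ubound A u -> u = +oo%E \/ exists n : nat, u = (n%:Z)%:E%E.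
  move=> /(_ _ Aa0) /(le_trans (A0 _ Aa0)).
  by case: u => [[n|n]||] //; [right; exists n|left].
have [[n An]|nA] := pselect (exists n : nat, ubound A (n%:Z)%:E%E).
- have exn : exists n : nat, `[< ubound A (n%:Z)%:E%E >] by exists n; apply/asboolP.
  case: (ex_minnP exn) => m /asboolP Am mmin.
  exists (m%:Z)%:E%E; split=> // u Au.
  have [->|[k uk]] := ub_cases _ Au; first exact: leey.
  by rewrite uk lee_fin lez_nat; apply: mmin; apply/asboolP; rewrite -uk.
- exists +oo%E; split=> [u _|u Au]; first exact: leey.
  have [->|[k uk]] := ub_cases _ Au; first exact: lexx.
  by case: nA; exists k; rewrite -uk.
Qed.

Lemma supremum_ereal_int_ub {A : set (\bar int)} {x0 a : \bar int} :
  (forall b, A b -> (0 <= b)%E) -> A a -> (a <= supremum x0 A)%E.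
Proof.
move=> A0 Aa; apply: ge_supremum_Nmem (Aa).
by apply: supremums_ereal_int_neq0 A0; exists a.
Qed.

Section PosetDimension.
Context {d} {L : completeLatticeType d} {X : set L}.

Lemma ht_ge {x : L} {n : nat} : chain_lengths X x n -> ((n%:Z)%:E <= ht X x)%E.
Proof.
move=> xn; apply: supremum_ereal_int_ub; last by exists n.
by move=> _ [k _ <-]; rewrite lee_fin.
Qed.

Lemma chain_lengths0 {x : L} : X x -> chain_lengths X x 0.
Proof.
by move=> Xx; exists (fun=> x); split=> // i j; rewrite !ord1 ltxx.
Qed.

Lemma Kdim_ge {x : L} : X x -> (ht X x <= Kdim X)%E.
Proof.
move=> Xx; apply: supremum_ereal_int_ub; last by exists x.
by move=> _ [y Xy <-]; apply: ht_ge (chain_lengths0 Xy).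
Qed.

Lemma not_MaxX {x : L} : X x -> ~ MaxX X x -> exists2 y, X y & (x < y)%O.
Proof.
move=> Xx nx; apply: contrapT => ny; apply: nx; split=> // y Xy xy.
apply: contrapT => /eqP neq; apply: ny; exists y => //.
by rewrite lt_neqAle eq_sym neq.
Qed.

Lemma not_MinX {x : L} : X x -> ~ MinX X x -> exists2 y, X y & (y < x)%O.
Proof.
move=> Xx nx; apply: contrapT => ny; apply: nx; split=> // y Xy yx.
apply: contrapT => /eqP neq; apply: ny; exists y => //.
by rewrite lt_neqAle neq.
Qed.

(** A point neither maximal nor minimal is the middle of a chain of length 2; conversely, the second
    entry of any chain of length at least 2 is such a point. *)
Lemma Kdim_le1P :
  (Kdim X <= 1%:E)%E <-> (forall x, X x -> MaxX X x \/ MinX X x).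
Proof.
split=> [X1 x Xx|XE].
- apply: contrapT => /not_orP[/(not_MaxX Xx)[z Xz xz] /(not_MinX Xx)[y Xy yx]].
  suff /ht_ge z2 : chain_lengths X z 2.
    by have := le_trans (le_trans z2 (Kdim_ge Xz)) X1.
  (* The default [z] of [nth] supplies the last entry of the chain [y < x < z]. *)
  exists (fun i : 'I_3 => nth z [:: y; x] i); split=> //.
  + by case=> [[|[|[|]]]].
  + case=> [[|[|[|//]]] ?] [[|[|[|//]]] ?] //= _.
    exact: lt_trans yx xz.
- apply: supremum_le => // _ [x _ <-]; apply: supremum_le => // _ [n + <-].
  (* Lengths 0 and 1 satisfy the bound; a chain of length [n.+2] has entries 0, 1 and 2, and entry 1
     gives the contradiction. *)
  case: n => [|[|n]] [c [Xc c_lt _]] //; exfalso.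
  have lt01 := c_lt (inord 0) (inord 1); have lt12 := c_lt (inord 1) (inord 2).
  rewrite !ltEord !inordK // in lt01 lt12.
  have {}lt01 := lt01 isT; have {}lt12 := lt12 isT.
  have [[_ maxc]|[_ minc]] := XE _ (Xc (inord 1)).
  + by move: (lt12); rewrite (maxc _ (Xc _) (ltW lt12)) ltxx.
  + by move: (lt01); rewrite (minc _ (Xc _) (ltW lt01)) ltxx.
Qed.

End PosetDimension.

Section ZariskiPoints.
Context {d} {L : completeLatticeType d} {X : set L} (XT : Xtop X).
Implicit Types x y : zariski XT.

Let point {a : L} (Xa : X a) : zariski XT := SigSub (mem_set Xa).

Let pointE {a : L} (Xa : X a) : set_val (point Xa) = a.
Proof. by []. Qed.

Let zariskiP x : X (set_val x). Proof. exact: set_valP. Qed.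

Let set_val_zinj {x y} : set_val x = set_val y -> x = y.
Proof. exact: val_inj. Qed.

Lemma zariski_D (a : L) x : (set_val @^-1` D X a) x <-> ~ (a <= set_val x)%O.
Proof.
split=> [[_ nV] ax|nax]; first by apply: nV; split=> //; apply: zariskiP.
by split=> [|[]//]; apply: zariskiP.
Qed.

Lemma closed_set1_zariski {x} : closed [set x] <-> MaxX X (set_val x).
Proof.
rewrite -openC zariski_openE; split=> [[a aE]|[_ xmax]].
(* That is, [V(a) = {x}]; since [V(a)] is an up-set, nothing in [X] lies strictly above [x]. *)
- have aP y : (a <= set_val y)%O <-> y = x.
    have := zariski_D a y; rewrite -aE /= => H.
    by split=> h; apply: contrapT => n; have [] := H; tauto.
  split=> [|y Xy xy]; first exact: zariskiP.
  rewrite -(pointE Xy); congr set_val; apply/aP; rewrite pointE.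
  by apply: le_trans xy; apply/aP.
- exists (set_val x); apply/seteqP; split=> y.
  + move=> nyx; apply/zariski_D => xy; apply: nyx.
    by apply: set_val_zinj; apply: xmax => //; apply: zariskiP.
  + by move=> /zariski_D nxy yx; apply: nxy; rewrite yx.
Qed.

(** If [y] is not below [x], then [D(y)] is an open set containing [x] but not [y]. Conversely,
    every open set [D(a)] is a down-set. *)
Lemma bigcap_open_zariski x :
  \bigcap_(U in [set U : set (zariski XT) | open U /\ U x]) U
  = [set y | (set_val y <= set_val x)%O].
Proof.
apply/seteqP; split=> y /=.
- move=> yU; apply: contrapT => nyx.
  have /zariski_D := yU (set_val @^-1` D X (set_val y))
    (conj ((zariski_openE _).2 (ex_intro _ _ erefl)) ((zariski_D _ _).2 nyx)).
  by apply.
- move=> yx _ [/zariski_openE[a ->] /zariski_D nax].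
  by apply/zariski_D => ay; apply: nax; apply: le_trans ay yx.
Qed.

Lemma bigcap_open_set1_zariski {x} :
  [set x] = \bigcap_(U in [set U : set (zariski XT) | open U /\ U x]) U <->
  MinX X (set_val x).
Proof.
rewrite bigcap_open_zariski; split=> [xE|[_ xmin]].
- split=> [|y Xy yx]; first exact: zariskiP.
  have : [set y | (set_val y <= set_val x)%O] (point Xy) by [].
  by rewrite -xE => <-.
- apply/seteqP; split=> [y -> //=|y /= yx].
  by apply: set_val_zinj; apply: xmin => //; apply: zariskiP.
Qed.

Lemma open_set1_zariski {x} :
  open [set x] <-> (MinX X `&` CSI X) (set_val x).
Proof.
rewrite zariski_openE; split=> [[a aE]|[[Xx xmin] [_ xcsi]]].
- have aP y : ~ (a <= set_val y)%O <-> y = x.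
    by have := zariski_D a y; rewrite -aE /= => H; split; apply H.
  have nax := (aP x).2 erefl.
  (* As [D(a) = {x}], the element [a] is below all other points. If no member of [A] were below [x],
     then [a] would be below the meet of [A], hence below [x]. *)
  have le_a b : X b -> ~ (b <= set_val x)%O -> (a <= b)%O.
    move=> Xb nbx; apply: contrapT; rewrite -(pointE Xb) => /aP bx.
    by apply: nbx; rewrite -bx pointE.
  split; split; try exact: zariskiP.
  + move=> y Xy yx; rewrite -(pointE Xy); congr set_val; apply/aP => ay.
    by apply: nax; apply: le_trans ay yx.
  + move=> A AX Ax; apply: contrapT => nA; apply: nax; apply: le_trans Ax.
    apply: (bigmeetP A).2 => b Ab; apply: le_a; first exact: AX.
    by move=> bx; apply: nA; exists b.
(* This meet is below every point other than [x]. Were it below [x], complete strong irreducibility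
   would put another point below [x], against minimality. *)
- exists (bigmeet (X `\ set_val x)); apply/seteqP; split=> y.
  + move=> ->; apply/zariski_D => /xcsi[b [] //|a [Xa nax] ax].
    by apply: nax; apply: xmin.
  + move=> /zariski_D ny; apply: contrapT => nyx; apply: ny.
    apply: (bigmeetP _).1; split; first exact: zariskiP.
    by move=> /set_val_zinj.
Qed.

(** Passes between points of the space, which carry a membership proof, and elements of [X] in
    [L]. *)
Lemma zariski_ind (P : L -> Prop) :
  (forall x : zariski XT, P (set_val x)) <-> (forall a, X a -> P a).
Proof.
split=> [h a Xa|h x]; first by rewrite -(pointE Xa).
exact/h/zariskiP.
Qed.

End ZariskiPoints.

Theorem theorem3p9 (d : Order.disp_t) (L : completeLatticeType d) (X : set L)
    (X1 : ~ X \top%O) (XT : Xtop X) :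
  [<-> T_half (zariski XT);
       X = MaxX X `|` (MinX X `&` CSI X);
       (Kdim X <= 1%:E)%E /\ ES X;
       T_quarter (zariski XT) /\ ES X].
Proof.
tfae.
- move=> Xh; apply/seteqP; split=> [|a [[]//|[[]//]]].
  apply/(zariski_ind XT) => x.
  by case: (Xh x) => [/closed_set1_zariski|/open_set1_zariski]; [left|right].
- move=> XE; split; last first.
    by move=> m [[Xm _] nm]; move: Xm; rewrite {1}XE => -[//|[]].
  by apply/Kdim_le1P => x; rewrite {1}XE => -[|[]]; [left|right].
- move=> [/Kdim_le1P/(zariski_ind XT) XE Xes]; split=> // x.
  by case: (XE x) => [/closed_set1_zariski|/bigcap_open_set1_zariski];
    [left|right].
(* A point that is not closed is not maximal, so it is minimal by [T_quarter], and [ES] then makes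
   it open. *)
- move=> [Xq Xes] x; have [|nx] := pselect (closed [set x]); first by left.
  right; case: (Xq x) => // /bigcap_open_set1_zariski xmin.
  apply/open_set1_zariski; split=> //; apply: Xes; split=> //.
  by move=> /closed_set1_zariski.
Qed.
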